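(* Let $G$ be a crossed interval group. For every congruence family $K$ on $G$, the functor $q:\nabla_G\to\mathcal Q_K$, which is the identity on objects and sends $(\varphi,x)$ to $(\varphi,[x])$, exhibits $\mathcal Q_K$ as a $G$-quotal category. Moreover, the assignment $K\mapsto\mathcal Q_K$ gives a one-to-one correspondence between congruence families on $G$ and isomorphism classes of $G$-quotal categories (isomorphism meaning isomorphism of categories compatible with the functors from $\nabla_G$), and it respects the orders: if $K_\varphi\subset K'_\varphi$ for every morphism $\varphi$ of $\nabla$, then there is a functor $\mathcal Q_K\to\mathcal Q_{K'}$ compatible with the functors from $\nabla_G$.
   Context: $\nabla$ is the category whose objects are the totally ordered sets $\langle\!\langle n\rangle\!\rangle=\{-\infty,1,\dots,n,\infty\}$ ($n\in\mathbb N$, $n\ge 0$) and whose morphisms are the order-preserving maps sending $\pm\infty$ to $\pm\infty$ respectively. A crossed interval group $G$ is a presheaf of sets on $\nabla$ (write $G_n=G(\langle\!\langle n\rangle\!\rangle)$ and $\varphi^*:G_n\to G_m$ for $\varphi:\langle\!\langle m\rangle\!\rangle\to\langle\!\langle n\rangle\!\rangle$) together with a group structure on each $G_n$ (unit $e_n$) and left group actions $G_n\times\nabla(\langle\!\langle m\rangle\!\rangle,\langle\!\langle n\rangle\!\rangle)\to\nabla(\langle\!\langle m\rangle\!\rangle,\langle\!\langle n\rangle\!\rangle)$, $(x,\varphi)\mapsto\varphi^x$, such that $\varphi^*(xy)=(\varphi^y)^*(x)\,\varphi^*(y)$ and $(\varphi\psi)^x=\varphi^x\psi^{\varphi^*(x)}$.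 The total category $\nabla_G$ has the same objects as $\nabla$; a morphism $\langle\!\langle m\rangle\!\rangle\to\langle\!\langle n\rangle\!\rangle$ is a pair $(\varphi,x)$ with $\varphi\in\nabla(\langle\!\langle m\rangle\!\rangle,\langle\!\langle n\rangle\!\rangle)$, $x\in G_m$; composition is $(\psi,y)\circ(\varphi,x)=(\psi\varphi^y,\varphi^*(y)x)$. A $G$-quotal category is a category $\mathcal Q$ with a functor $q:\nabla_G\to\mathcal Q$ that is full and bijective on objects and such that $q(\varphi,x)=q(\varphi',x')$ (for $\varphi,\varphi'\in\nabla(\langle\!\langle m\rangle\!\rangle,\langle\!\langle n\rangle\!\rangle)$, $x,x'\in G_m$) implies $\varphi=\varphi'$. For $\varphi:\langle\!\langle m\rangle\!\rangle\to\langle\!\langle n\rangle\!\rangle$, $\mathrm{RSt}^G_\varphi\subset G_m$ is the subgroup of right stabilizers: those $x\in G_m$ with $\varphi\psi^x=\varphi\psi$ for every morphism $\psi:\langle\!\langle l\rangle\!\rangle\to\langle\!\langle m\rangle\!\rangle$. A congruence family on $G$ is a family $K=\{K_\varphi\}_\varphi$ indexed by the morphisms of $\nabla$ such that, for every $\varphi:\langle\!\langle m\rangle\!\rangle\to\langle\!\langle n\rangle\!\rangle$: (i) $K_\varphi$ is a subgroup of $\mathrm{RSt}^G_\varphi$; (ii) $K_\varphi\subset K_{\chi\varphi}$ for every $\chi:\langle\!\langle n\rangle\!\rangle\to\langle\!\langle k\rangle\!\rangle$; (iii) $\psi^*(K_\varphi)\subset K_{\varphi\psi}$ for every $\psi:\langle\!\langle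 l\rangle\!\rangle\to\langle\!\langle m\rangle\!\rangle$; (iv) $\varphi^*(y)\,K_\varphi\,\varphi^*(y)^{-1}=K_{\varphi^y}$ for every $y\in G_n$. For a congruence family $K$, the category $\mathcal Q_K$ has the same objects as $\nabla$ and $\mathcal Q_K(\langle\!\langle m\rangle\!\rangle,\langle\!\langle n\rangle\!\rangle)=\{(\varphi,[x])\mid\varphi\in\nabla(\langle\!\langle m\rangle\!\rangle,\langle\!\langle n\rangle\!\rangle),\ [x]\in K_\varphi\backslash G_m\}$, with composition induced from $\nabla_G$: $(\psi,[y])\circ(\varphi,[x])=(\psi\varphi^y,[\varphi^*(y)x])$. *)

(* Defs.v *)
From HB Require Import structures.
From mathcomp Require Import all_boot generic_quotient.
From mathcomp Require Import boolp classical_sets.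

Set Implicit Arguments.
Unset Strict Implicit.
Unset Printing Implicit Defensive.

Local Open Scope classical_set_scope.
Local Open Scope group_scope.

(* Homs are compared by Leibniz equality; [cat_comp f g] is f after g. *)
Record category := Category {
  cat_ob :> Type;
  cat_hom : cat_ob -> cat_ob -> Type;
  cat_id : forall a, cat_hom a a;
  cat_comp : forall a b c, cat_hom b c -> cat_hom a b -> cat_hom a c;
  cat_compA : forall a b c d (h : cat_hom c d) (g : cat_hom b c)
    (f : cat_hom a b), cat_comp h (cat_comp g f) = cat_comp (cat_comp h g) f;
  cat_comp1l : forall a b (f : cat_hom a b), cat_comp (cat_id b) f = f;
  cat_comp1r : forall a b (f : cat_hom a b), cat_comp f (cat_id a) = f }.
Arguments cat_hom : clear implicits.

Record functor (C D : category) := Functor {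
  fun_ob :> C -> D;
  fun_hom : forall a b, cat_hom C a b -> cat_hom D (fun_ob a) (fun_ob b);
  fun_hom1 : forall a, fun_hom (cat_id a) = cat_id (fun_ob a);
  fun_homM : forall a b c (g : cat_hom C b c) (f : cat_hom C a b),
    fun_hom (cat_comp g f) = cat_comp (fun_hom g) (fun_hom f) }.

Definition functor_id (C : category) : functor C C :=
  @Functor C C id (fun _ _ f => f) (fun=> erefl) (fun _ _ _ _ _ => erefl).

Section FunctorComp.
Variables (C D E : category) (F : functor D E) (H : functor C D).

Lemma functor_comp_hom1 a :
  fun_hom F (fun_hom H (cat_id a)) = cat_id (F (H a)).
Proof. by rewrite !fun_hom1. Qed.

Lemma functor_comp_homM a b c (g : cat_hom C b c) (f : cat_hom C a b) :
  fun_hom F (fun_hom H (cat_comp g f)) =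
  cat_comp (fun_hom F (fun_hom H g)) (fun_hom F (fun_hom H f)).
Proof. by rewrite !fun_homM. Qed.

Definition functor_comp : functor C E :=
  Functor functor_comp_hom1 functor_comp_homM.

End FunctorComp.

Definition functor_iso (C D : category) (F : functor C D) : Prop :=
  exists F' : functor D C,
    functor_comp F' F = functor_id C /\ functor_comp F F' = functor_id D.

Definition full (C D : category) (F : functor C D) : Prop :=
  forall a b (g : cat_hom D (F a) (F b)),
    exists f : cat_hom C a b, fun_hom F f = g.

(* Categories equipped with a functor from C. *)
Record under (C : category) := Under {
  under_cat :> category;
  under_fun : functor C under_cat }.

Definition under_compatible (C : category) (U V : under C)
    (F : functor U V) : Prop :=
  functor_comp F (under_fun U) = under_fun V.

Definition under_iso (C : category) (U V : under C) : Prop :=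
  exists F : functor U V, functor_iso F /\ under_compatible F.

(* Isomorphism classes are plain predicates: the universe of the library's
   [set] is bounded by that of [eqType], hence too small for [under C]. *)
Definition iso_class (C : category) (U : under C) : under C -> Prop :=
  fun V => under_iso U V.

(* The object <<n>> = {-oo, 1, ..., n, +oo} is 'I_n.+2 with its usual order:
   ord0 is -oo and ord_max is +oo. *)
Definition is_nabla m n (f : {ffun 'I_m.+2 -> 'I_n.+2}) : bool :=
  [&& [forall i : 'I_m.+2, forall j : 'I_m.+2, (i <= j) ==> (f i <= f j)],
      f ord0 == ord0 & f ord_max == ord_max].

Record nabla m n := Nabla {
  nabla_fun :> {ffun 'I_m.+2 -> 'I_n.+2};
  _ : is_nabla nabla_fun }.

HB.instance Definition _ m n := [isSub for @nabla_fun m n].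

Lemma nabla_ext m n (f g : nabla m n) : f =1 g -> f = g.
Proof. by move=> fg; apply/val_inj/ffunP. Qed.

Lemma nabla_id_subproof n : is_nabla [ffun i : 'I_n.+2 => i].
Proof.
apply/and3P; split; rewrite ?ffunE //.
by apply/forallP => i; apply/forallP => j; rewrite !ffunE; apply/implyP.
Qed.

Definition nabla_id n : nabla n n := Nabla (nabla_id_subproof n).

Lemma nabla_comp_subproof l m n (f : nabla m n) (g : nabla l m) :
  is_nabla [ffun i => f (g i)].
Proof.
case: f g => f fP [g gP] /=.
have /and3P[/forallP fm /eqP f0 /eqP f1] := fP.
have /and3P[/forallP gm /eqP g0 /eqP g1] := gP.
apply/and3P; split; rewrite ?ffunE ?g0 ?f0 ?g1 ?f1 //.
apply/forallP => i; apply/forallP => j; rewrite !ffunE; apply/implyP => ij.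
apply: (implyP (forallP (fm (g i)) (g j))).
exact: (implyP (forallP (gm i) j)).
Qed.

Definition nabla_comp l m n (f : nabla m n) (g : nabla l m) : nabla l n :=
  Nabla (nabla_comp_subproof f g).

Notation "f \on g" := (nabla_comp f g) (at level 40, left associativity).

Lemma nabla_compA k l m n (f : nabla m n) (g : nabla l m) (h : nabla k l) :
  f \on (g \on h) = f \on g \on h.
Proof. by apply: nabla_ext => i; rewrite !ffunE. Qed.

Lemma nabla_comp1l m n (f : nabla m n) : nabla_id n \on f = f.
Proof. by apply: nabla_ext => i; rewrite !ffunE. Qed.

Lemma nabla_comp1r m n (f : nabla m n) : f \on nabla_id m = f.
Proof. by apply: nabla_ext => i; rewrite !ffunE. Qed.

(* [cig_pull f x] is f^*(x) and [cig_act x f] is f^x.  The maps f^* are not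
   required to be group homomorphisms. *)
Record crossed_interval_group := CrossedIntervalGroup {
  cig_group :> nat -> groupType;
  cig_pull : forall m n, nabla m n -> cig_group n -> cig_group m;
  cig_act : forall m n, cig_group n -> nabla m n -> nabla m n;
  cig_pull_id : forall n (x : cig_group n), cig_pull (nabla_id n) x = x;
  cig_pull_comp : forall l m n (f : nabla m n) (g : nabla l m)
    (x : cig_group n), cig_pull (f \on g) x = cig_pull g (cig_pull f x);
  cig_act1 : forall m n (f : nabla m n), cig_act 1 f = f;
  cig_actM : forall m n (x y : cig_group n) (f : nabla m n),
    cig_act (x * y) f = cig_act x (cig_act y f);
  cig_pullM : forall m n (f : nabla m n) (x y : cig_group n),
    cig_pull f (x * y) = cig_pull (cig_act y f) x * cig_pull f y;
  cig_act_comp : forall l m n (x : cig_group n) (f : nabla m n)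
    (g : nabla l m),
    cig_act x (f \on g) = cig_act x f \on cig_act (cig_pull f x) g }.

Section TotalCategory.
Variable G : crossed_interval_group.

Lemma cig_pull1 m n (f : nabla m n) : cig_pull f 1 = 1 :> G m.
Proof.
have := cig_pullM f (1 : G n) 1; rewrite mul1g cig_act1 => e.
by apply: (mulIg (cig_pull f (1 : G n))); rewrite mul1g -e.
Qed.

Lemma cig_act_id n (x : G n) : cig_act x (nabla_id n) = nabla_id n.
Proof.
have := cig_act_comp x (nabla_id n) (cig_act x^-1 (nabla_id n)).
by rewrite nabla_comp1l cig_pull_id -cig_actM mulgV cig_act1 nabla_comp1r.
Qed.

Definition total_hom m n : Type := (nabla m n * G m)%type.

Definition total_id n : total_hom n n := (nabla_id n, 1).

Definition total_comp l m n (g : total_hom m n) (f : total_hom l m) :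
    total_hom l n :=
  (g.1 \on cig_act g.2 f.1, cig_pull f.1 g.2 * f.2).

Lemma total_compA k l m n (h : total_hom m n) (g : total_hom l m)
    (f : total_hom k l) :
  total_comp h (total_comp g f) = total_comp (total_comp h g) f.
Proof.
by rewrite /total_comp /= cig_act_comp cig_pull_comp cig_pullM cig_actM
           nabla_compA mulgA.
Qed.

Lemma total_comp1l m n (f : total_hom m n) : total_comp (total_id n) f = f.
Proof.
by case: f => f x; rewrite /total_comp /= cig_act1 nabla_comp1l cig_pull1 mul1g.
Qed.

Lemma total_comp1r m n (f : total_hom m n) : total_comp f (total_id m) = f.
Proof.
by case: f => f x;
  rewrite /total_comp /= cig_act_id nabla_comp1r cig_pull_id mulg1.
Qed.

Definition total_category : category :=
  @Category nat total_hom total_id total_comp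
    total_compA total_comp1l total_comp1r.

(* A pair (Q, q) being a G-quotal category. *)
Definition quotal (Q : under total_category) : Prop :=
  let q := under_fun Q in
  [/\ full q, bijective q &
      forall m n (f f' : nabla m n) (x x' : G m),
        fun_hom q ((f, x) : cat_hom total_category m n) =
        fun_hom q ((f', x') : cat_hom total_category m n) -> f = f'].

Definition quotal_class (c : under total_category -> Prop) : Prop :=
  exists2 Q : under total_category, quotal Q & c = iso_class Q.

Definition RSt m n (f : nabla m n) : set (G m) :=
  [set x | forall l (g : nabla l m), f \on cig_act x g = f \on g].

Record congruence_family := CongruenceFamily {
  cong_set : forall m n, nabla m n -> set (G m);
  cong_group : forall m n (f : nabla m n), group_closed [in cong_set f];
  cong_RSt : forall m n (f : nabla m n), cong_set f `<=` RSt f;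
  cong_post : forall m n k (f : nabla m n) (h : nabla n k),
    cong_set f `<=` cong_set (h \on f);
  cong_pre : forall l m n (f : nabla m n) (g : nabla l m),
    cig_pull g @` cong_set f `<=` cong_set (f \on g);
  cong_conj : forall m n (f : nabla m n) (y : G n),
    [set cig_pull f y * k * (cig_pull f y)^-1 | k in cong_set f] =
    cong_set (cig_act y f) }.

End TotalCategory.

Section QuotientCategory.
Variables (G : crossed_interval_group) (K : congruence_family G).

(* K_f x = K_f y iff x y^-1 belongs to K_f. *)
Definition cong_rel m n (f : nabla m n) (x y : G m) : bool := x / y \in cong_set K f.

Lemma cong_in1 m n (f : nabla m n) : 1 \in cong_set K f.
Proof. by have [] := cong_group K f. Qed.

Lemma cong_inF m n (f : nabla m n) (x y : G m) :
  x \in cong_set K f -> y \in cong_set K f -> x / y \in cong_set K f.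
Proof. by have [_] := cong_group K f; apply. Qed.

Lemma cong_rel_refl m n (f : nabla m n) : reflexive (cong_rel f).
Proof. by move=> x; rewrite /cong_rel mulgV cong_in1. Qed.

Lemma cong_rel_trans m n (f : nabla m n) : transitive (cong_rel f).
Proof.
move=> y x z xy yz.
have zy : z / y \in cong_set K f.
  by have := cong_inF (cong_in1 f) yz; rewrite mul1g invgM invgK.
by have := cong_inF xy zy; rewrite invgM invgK mulgA mulgVK.
Qed.

Lemma cong_rel_sym m n (f : nabla m n) : symmetric (cong_rel f).
Proof.
suff H x y : cong_rel f x y -> cong_rel f y x.
  by move=> x y; apply/idP/idP; apply: H.
by move=> /(cong_inF (cong_in1 f)); rewrite mul1g invgM invgK.
Qed.

Canonical cong_equiv m n (f : nabla m n) : equiv_rel (G m) :=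
  EquivRel (cong_rel f) (@cong_rel_refl m n f) (@cong_rel_sym m n f)
           (@cong_rel_trans m n f).

(* The set K_f \ G_m of cosets K_f x. *)
Definition coset_quot m n (f : nabla m n) := {eq_quot (cong_equiv f)}%qT.

HB.instance Definition _ m n (f : nabla m n) := EqQuotient.on (coset_quot f).

Definition quot_hom m n : Type := {f : nabla m n & coset_quot f}.

Definition quot_class m n (f : nabla m n) (x : G m) : quot_hom m n :=
  existT _ f (\pi_(coset_quot f) x)%qT.

Lemma quot_classP m n (f : nabla m n) (x y : G m) :
  x / y \in cong_set K f -> quot_class f x = quot_class f y.
Proof. by move=> xy; congr existT; apply/eqmodP. Qed.

Definition quot_id n : quot_hom n n := quot_class (nabla_id n) 1.

(* Composition is computed on chosen representatives; it does not depend on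
   the choice by [quot_compE]. *)
Definition quot_comp l m n (g : quot_hom m n) (f : quot_hom l m) :
    quot_hom l n :=
  quot_class (tag g \on cig_act (repr (tagged g)) (tag f))
             (cig_pull (tag f) (repr (tagged g)) * repr (tagged f)).

Lemma quot_repr m n (f : nabla m n) (x : G m) :
  repr (\pi_(coset_quot f) x)%qT / x \in cong_set K f.
Proof.
by have /eqmodP : (repr (\pi_(coset_quot f) x) = x %[mod (coset_quot f)])%qT
  by rewrite reprK.
Qed.

Lemma quot_comp_indep l m n (g : nabla m n) (f : nabla l m) (y y' : G m)
    (x x' : G l) :
  y' / y \in cong_set K g -> x' / x \in cong_set K f ->
  quot_class (g \on cig_act y' f) (cig_pull f y' * x') =
  quot_class (g \on cig_act y f) (cig_pull f y * x).
Proof.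
set k := y' / y; set h := x' / x => kK hK.
have -> : y' = k * y by rewrite /k mulgVK.
have -> : x' = h * x by rewrite /h mulgVK.
have gE : g \on cig_act (k * y) f = g \on cig_act y f.
  by rewrite cig_actM; apply: (cong_RSt (set_mem kK)).
rewrite gE; apply: quot_classP; rewrite cig_pullM.
have aK : cig_pull (cig_act y f) k \in cong_set K (g \on cig_act y f).
  by apply/mem_set/cong_pre; exists k => //; apply: set_mem.
have bK : cig_pull f y * h * (cig_pull f y)^-1 \in cong_set K (g \on cig_act y f).
  apply/mem_set/cong_post; rewrite -cong_conj.
  by exists h => //; apply: set_mem.
have /(cong_inF aK) := cong_inF (cong_in1 _) bK.
by rewrite mul1g invgK invgM !mulgA mulgK.
Qed.

Lemma quot_compE l m n (g : nabla m n) (f : nabla l m) (y : G m) (x : G l) :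
  quot_comp (quot_class g y) (quot_class f x) =
  quot_class (g \on cig_act y f) (cig_pull f y * x).
Proof. by apply: quot_comp_indep; apply: quot_repr. Qed.

Lemma quot_homP m n (f : quot_hom m n) : exists g x, f = quot_class g x.
Proof.
by case: f => g c; exists g, (repr c); rewrite /quot_class reprK.
Qed.

Lemma quot_compA k l m n (h : quot_hom m n) (g : quot_hom l m)
    (f : quot_hom k l) :
  quot_comp h (quot_comp g f) = quot_comp (quot_comp h g) f.
Proof.
have [h' [z ->]] := quot_homP h.
have [g' [y ->]] := quot_homP g.
have [f' [x ->]] := quot_homP f.
rewrite !quot_compE.
exact: (congr1 (fun p => quot_class p.1 p.2)
               (total_compA (h', z) (g', y) (f', x))).
Qed.

Lemma quot_comp1l m n (f : quot_hom m n) : quot_comp (quot_id n) f = f.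
Proof.
have [g [x ->]] := quot_homP f.
rewrite quot_compE.
exact: (congr1 (fun p => quot_class p.1 p.2) (total_comp1l (g, x))).
Qed.

Lemma quot_comp1r m n (f : quot_hom m n) : quot_comp f (quot_id m) = f.
Proof.
have [g [x ->]] := quot_homP f.
rewrite quot_compE.
exact: (congr1 (fun p => quot_class p.1 p.2) (total_comp1r (g, x))).
Qed.

Definition quot_category : category :=
  @Category nat quot_hom quot_id quot_comp
    quot_compA quot_comp1l quot_comp1r.

Definition quot_functor_hom m n (f : cat_hom (total_category G) m n) :
  cat_hom quot_category m n := quot_class f.1 f.2.

Lemma quot_functor_homM l m n (g : cat_hom (total_category G) m n)
    (f : cat_hom (total_category G) l m) :
  quot_functor_hom (cat_comp g f) =
  cat_comp (quot_functor_hom g) (quot_functor_hom f).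
Proof. by rewrite /quot_functor_hom /= quot_compE. Qed.

Definition quot_functor : functor (total_category G) quot_category :=
  @Functor (total_category G) quot_category id quot_functor_hom
    (fun=> erefl) quot_functor_homM.

Definition QK : under (total_category G) := Under quot_functor.

End QuotientCategory.

(* Main.v *)
(** A G-quotal category q : nabla_G -> Q is determined by its kernel, the sets
    of those x with q(f, x) = q(f, 1).  Since (f, x) o (id, z) = (f, xz),
    the equality q(f, x) = q(f, y) means that x y^-1 is in the kernel at f; the
    axioms of a congruence family come from composing (f, x) with (g, 1),
    (h, 1) and (id, y).  The kernel of Q_K is K, an isomorphism under nabla_G
    preserves kernels, and q factors through the Q_K of its kernel by a fully
    faithful functor that is bijective on objects, hence an isomorphism. *)

Require Import Defs.
From mathcomp Require Import all_boot generic_quotient.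
From mathcomp Require Import boolp classical_sets.

Local Open Scope classical_set_scope.

Set Implicit Arguments.
Unset Strict Implicit.
Unset Printing Implicit Defensive.

Local Open Scope group_scope.

(** * Transport of morphisms along equalities of objects *)

Section HomCast.
Variable C : category.

(** Functors that agree on objects only up to a proved equality have morphism parts of different
    types; this cast lets them be compared. *)
Definition hom_cast (a a' b b' : C) (ea : a = a') (eb : b = b')
    (f : cat_hom C a b) : cat_hom C a' b' :=
  ecast y (cat_hom C a' y) eb (ecast x (cat_hom C x b) ea f).

Lemma hom_castK (a a' b b' : C) (ea : a' = a) (eb : b' = b)
    (f : cat_hom C a b) :
  hom_cast ea eb (hom_cast (esym ea) (esym eb) f) = f.
Proof. by case: _ / ea f; case: _ / eb. Qed.

Lemma hom_cast1 (a a' : C) (ea : a = a') :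
  hom_cast ea ea (cat_id a) = cat_id a'.
Proof. by case: _ / ea. Qed.

Lemma hom_castM (a a' b b' c c' : C) (ea : a = a') (eb : b = b') (ec : c = c')
    (g : cat_hom C b c) (f : cat_hom C a b) :
  hom_cast ea ec (cat_comp g f) =
  cat_comp (hom_cast eb ec g) (hom_cast ea eb f).
Proof. by case: _ / ea; case: _ / ec; case: _ / eb g f. Qed.

End HomCast.

(** * Extensionality and inversion of functors *)

Section Functors.
Variables C D : category.

(** By proof irrelevance [eFa] and [eFb] may be any proofs, not just the images of [ea] and [eb]
    under [F]. *)
Lemma fun_hom_cast (F : functor C D) (a a' b b' : C) (ea : a = a')
    (eb : b = b') (eFa : F a = F a') (eFb : F b = F b') (f : cat_hom C a b) :
  hom_cast eFa eFb (fun_hom F f) = fun_hom F (hom_cast ea eb f).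
Proof.
case: _ / ea eFa; case: _ / eb eFb => eFb eFa.
by rewrite (Prop_irrelevance eFa erefl) (Prop_irrelevance eFb erefl).
Qed.

(** Once the object maps are identified, each [eo a] proves a reflexive equality, so the casts
    vanish by proof irrelevance. *)
Lemma functor_ext (F F' : functor C D) (eo : forall a, F a = F' a) :
  (forall a b (f : cat_hom C a b),
     hom_cast (eo a) (eo b) (fun_hom F f) = fun_hom F' f) -> F = F'.
Proof.
case: F F' eo => o h h1 hM [o' h' h1' hM'] /= eo.
have eoo : o = o' by apply: funext.
case: _ / eoo h' h1' hM' eo => h' h1' hM' eo ehom.
have ehh : h = h'.
  apply: functional_extensionality_dep => a.
  apply: functional_extensionality_dep => b.
  apply: functional_extensionality_dep => f.
  rewrite -ehom (Prop_irrelevance (eo a) erefl).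
  by rewrite (Prop_irrelevance (eo b) erefl).
case: _ / ehh h1' hM' {ehom} => h1' hM'.
by rewrite (Prop_irrelevance h1' h1) (Prop_irrelevance hM' hM).
Qed.

Definition faithful (F : functor C D) : Prop :=
  forall a b, injective (@fun_hom _ _ F a b).

Section Inverse.
Variables (F : functor C D) (Fb : D -> C).
Hypotheses (FK : cancel F Fb) (FbK : cancel Fb F).
Hypotheses (F_full : full F) (F_faithful : faithful F).

Definition full_lift (a b : C) (g : cat_hom D (F a) (F b)) : cat_hom C a b :=
  projT1 (cid (F_full g)).

Lemma full_liftK (a b : C) (g : cat_hom D (F a) (F b)) :
  fun_hom F (full_lift g) = g.
Proof. exact: projT2 (cid (F_full g)). Qed.

(** The cast turns [g] into a morphism between objects in the image of [F], where fullness provides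
    a preimage. *)
Definition inverse_hom (a b : D) (g : cat_hom D a b) :
    cat_hom C (Fb a) (Fb b) :=
  full_lift (hom_cast (esym (FbK a)) (esym (FbK b)) g).

Lemma inverse_hom1 (a : D) : inverse_hom (cat_id a) = cat_id (Fb a).
Proof. by apply: F_faithful; rewrite full_liftK hom_cast1 fun_hom1. Qed.

Lemma inverse_homM (a b c : D) (g : cat_hom D b c) (f : cat_hom D a b) :
  inverse_hom (cat_comp g f) = cat_comp (inverse_hom g) (inverse_hom f).
Proof.
by apply: F_faithful; rewrite fun_homM !full_liftK -hom_castM.
Qed.

Definition inverse_functor : functor D C := Functor inverse_hom1 inverse_homM.

End Inverse.
End Functors.

Lemma fully_faithful_bijective_iso (C D : category) (F : functor C D) :
  bijective F -> full F -> faithful F -> functor_iso F.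
Proof.
case=> Fb FK FbK F_full F_faithful.
pose F' := inverse_functor FbK F_full F_faithful.
exists F'; split.
  refine (@functor_ext _ _ (functor_comp F' F) (functor_id C) FK _) => a b f.
  (* Choosing [FbK] at [F a] and [F b] as the equalities in [D] makes the outer cast the inverse of
     the one inside [inverse_hom]. *)
  apply: (F_faithful); rewrite -(fun_hom_cast _ _ (FbK (F a)) (FbK (F b))).
  by rewrite /= full_liftK hom_castK.
refine (@functor_ext _ _ (functor_comp F F') (functor_id D) FbK _) => a b f.
by rewrite /= full_liftK hom_castK.
Qed.

(** * Isomorphism under a fixed category as an equivalence relation *)

Section UnderIso.
Variable C : category.

Lemma functor_compA (A B D E : category) (H : functor D E) (F : functor B D)
    (F' : functor A B) :
  functor_comp H (functor_comp F F') = functor_comp (functor_comp H F) F'.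
Proof. by congr Functor; apply: Prop_irrelevance. Qed.

Lemma functor_comp1l (A B : category) (F : functor A B) :
  functor_comp (functor_id B) F = F.
Proof. by case: F => *; congr Functor; apply: Prop_irrelevance. Qed.

Lemma functor_comp1r (A B : category) (F : functor A B) :
  functor_comp F (functor_id A) = F.
Proof. by case: F => *; congr Functor; apply: Prop_irrelevance. Qed.

Lemma under_iso_refl (U : under C) : under_iso U U.
Proof.
exists (functor_id U); split; last exact: functor_comp1l.
by exists (functor_id U); rewrite functor_comp1l.
Qed.

Lemma under_iso_sym (U V : under C) : under_iso U V -> under_iso V U.
Proof.
move=> [F [[F' [F'F FF']] UV]]; exists F'; split; first by exists F.
by rewrite /under_compatible -UV functor_compA F'F functor_comp1l.
Qed.

Lemma under_iso_trans (U V W : under C) :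
  under_iso U V -> under_iso V W -> under_iso U W.
Proof.
move=> [F [[F' [F'F FF']] UV]] [H [[H' [H'H HH']] VW]].
exists (functor_comp H F); split; last first.
  by rewrite /under_compatible -functor_compA UV.
exists (functor_comp F' H'); split.
  by rewrite functor_compA -(functor_compA F') H'H functor_comp1r.
by rewrite functor_compA -(functor_compA H) FF' functor_comp1r.
Qed.

Lemma iso_classP (U V : under C) : iso_class U = iso_class V <-> under_iso U V.
Proof.
split=> [UV|UV]; first by rewrite -/(iso_class U V) UV; apply: under_iso_refl.
apply: funext => W; apply: propext; split; apply: under_iso_trans => //.
exact: under_iso_sym.
Qed.

Lemma under_compatible_eq (U V : under C) (F : functor U V) (a b : C)
    (f f' : cat_hom C a b) :
  under_compatible F -> fun_hom (under_fun U) f = fun_hom (under_fun U) f' ->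
  fun_hom (under_fun V) f = fun_hom (under_fun V) f'.
Proof. by move=> <- /= ->. Qed.

End UnderIso.

(** * The kernel of a functor out of the total category *)

Section Kernel.
Variables (G : crossed_interval_group) (Q : under (total_category G)).

Definition under_hom m n (f : nabla m n) (x : G m) :=
  fun_hom (under_fun Q) ((f, x) : cat_hom (total_category G) m n).

Lemma under_homM l m n (g : nabla m n) (y : G m) (f : nabla l m) (x : G l) :
  cat_comp (under_hom g y) (under_hom f x) =
  under_hom (g \on cig_act y f) (cig_pull f y * x).
Proof. by rewrite /under_hom -fun_homM. Qed.

Lemma under_hom_mulr m n (f : nabla m n) (x z : G m) :
  under_hom f (x * z) = cat_comp (under_hom f x) (under_hom (nabla_id m) z).
Proof. by rewrite under_homM cig_act_id nabla_comp1r cig_pull_id. Qed.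

Definition kernel m n (f : nabla m n) : set (G m) :=
  [set x | under_hom f x = under_hom f 1].

Lemma kernelP m n (f : nabla m n) (x y : G m) :
  kernel f (x / y) <-> under_hom f x = under_hom f y.
Proof.
split=> [xy|xy].
  by rewrite -(mulgVK y x) under_hom_mulr xy -under_hom_mulr mul1g.
by rewrite /kernel /= under_hom_mulr xy -under_hom_mulr mulgV.
Qed.

Lemma kernel_group m n (f : nabla m n) : group_closed [in kernel f].
Proof.
split=> [|x y /set_mem xK /set_mem yK]; first exact/mem_set.
by apply/mem_set/kernelP; rewrite xK yK.
Qed.

Lemma kernel_post m n k (f : nabla m n) (h : nabla n k) :
  kernel f `<=` kernel (h \on f).
Proof.
move=> x xK.
have hfE z : under_hom (h \on f) z = cat_comp (under_hom h 1) (under_hom f z).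
  by rewrite under_homM cig_act1 cig_pull1 mul1g.
by rewrite /kernel /= !hfE xK.
Qed.

(** Composing ([id], [y]) with ([f], [z]) gives ([f^y], [f^*(y) z]); take [z = k] and [z = 1]. *)
Lemma kernel_conj_sub m n (f : nabla m n) (y : G n) (k : G m) :
  kernel f k -> kernel (cig_act y f) (cig_pull f y * k * (cig_pull f y)^-1).
Proof.
have yfE z : under_hom (cig_act y f) (cig_pull f y * z) =
    cat_comp (under_hom (nabla_id n) y) (under_hom f z).
  by rewrite under_homM nabla_comp1l.
by move=> kK; apply/kernelP; rewrite yfE kK -yfE mulg1.
Qed.

Lemma kernel_conj m n (f : nabla m n) (y : G n) :
  [set cig_pull f y * k * (cig_pull f y)^-1 | k in kernel f] =
  kernel (cig_act y f).
Proof.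
apply/seteqP; split=> [_ [k kK <-]|k kK]; first exact: kernel_conj_sub.
(* The reverse inclusion is the direct one for [y^-1] at [f^y]; the crossed product rule for
   [y^-1 y = 1] identifies the conjugating element. *)
have pullV : cig_pull (cig_act y f) y^-1 = (cig_pull f y)^-1.
  by apply: (mulIg (cig_pull f y)); rewrite -cig_pullM !mulVg cig_pull1.
have := kernel_conj_sub y^-1 kK.
rewrite -cig_actM mulVg cig_act1 pullV invgK => kK'.
exists ((cig_pull f y)^-1 * k * cig_pull f y) => //.
by rewrite !mulgA mulgV mul1g mulgK.
Qed.

Hypothesis Q_quotal : quotal Q.

Lemma under_hom_fst m n (f f' : nabla m n) (x x' : G m) :
  under_hom f x = under_hom f' x' -> f = f'.
Proof. by have [_ _] := Q_quotal; apply. Qed.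

(** Precomposing [q(f, x) = q(f, 1)] with [q(g, 1)] yields this. The quotal condition then equates
    the first components, which is the stabilizer axiom, and what remains is the pullback axiom. *)
Lemma kernel_homM l m n (f : nabla m n) (g : nabla l m) (x : G m) :
  kernel f x ->
  under_hom (f \on cig_act x g) (cig_pull g x) = under_hom (f \on g) 1.
Proof.
move=> xK; have := under_homM f x g 1; rewrite mulg1 => <-.
by rewrite xK under_homM cig_act1 cig_pull1 mulg1.
Qed.

Lemma kernel_RSt m n (f : nabla m n) : kernel f `<=` RSt f.
Proof. by move=> x xK l g; have /under_hom_fst := kernel_homM g xK. Qed.

Lemma kernel_pre l m n (f : nabla m n) (g : nabla l m) :
  cig_pull g @` kernel f `<=` kernel (f \on g).
Proof.
move=> _ [x xK <-]; rewrite /kernel /= -(kernel_homM g xK).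
by rewrite (kernel_RSt xK).
Qed.

Definition kernel_congruence : congruence_family G :=
  CongruenceFamily kernel_group kernel_RSt kernel_post kernel_pre kernel_conj.

End Kernel.

(** * The kernel of [QK K] and factorization through it *)

Section QuotientKernel.
Variables (G : crossed_interval_group) (K : congruence_family G).

Lemma quot_class_inj m n (f f' : nabla m n) (x x' : G m) :
  quot_class K f x = quot_class K f' x' -> f = f' /\ cong_set K f (x / x').
Proof.
move=> e; split; first exact: (congr1 (@tag _ _) e).
(* A predicate on the whole sigma type can be rewritten along [e], with no dependent elimination on
   the coset component. *)
pose P (p : quot_hom K m n) := repr (tagged p) / x' \in cong_set K (tag p).
have : P (quot_class K f x) by rewrite e /P; apply: quot_repr.
rewrite /P /= => xK; apply: set_mem; apply: cong_rel_trans xK.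
by rewrite cong_rel_sym; apply: quot_repr.
Qed.

Lemma kernel_QK m n (f : nabla m n) : kernel (QK K) f = cong_set K f.
Proof.
apply/seteqP; split=> x /=.
  by move=> /quot_class_inj[_]; rewrite invg1 mulg1.
by move=> xK; apply: quot_classP; rewrite invg1 mulg1; apply: mem_set.
Qed.

Lemma quotal_QK : quotal (QK K).
Proof.
split=> [m n g|| m n f f' x x' /quot_class_inj[]//].
  by have [f [x ->]] := quot_homP g; exists (f, x).
by exists id.
Qed.

Variable V : under (total_category G).
Hypothesis sKV : forall m n (f : nabla m n), cong_set K f `<=` kernel V f.

Definition factor_hom m n (p : quot_hom K m n) :=
  under_hom V (tag p) (repr (tagged p)).

(** The chosen representative differs from [x] by an element of [K_f], which [sKV] places in the
    kernel of [V]. *)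
Lemma factor_homE m n (f : nabla m n) (x : G m) :
  factor_hom (quot_class K f x) = under_hom V f x.
Proof. by apply/kernelP/sKV/set_mem/quot_repr. Qed.

Lemma factor_hom1 n :
  factor_hom (quot_id K n) = cat_id (under_fun V n).
Proof. by rewrite factor_homE -fun_hom1. Qed.

Lemma factor_homM l m n (q : quot_hom K m n) (p : quot_hom K l m) :
  factor_hom (quot_comp q p) = cat_comp (factor_hom q) (factor_hom p).
Proof.
have [g [y ->]] := quot_homP q; have [f [x ->]] := quot_homP p.
by rewrite quot_compE !factor_homE under_homM.
Qed.

(** Serves twice: with [V] a quotal category having kernel [K], and with [V] the quotient by a
    larger congruence family. *)
Definition factor_functor : functor (QK K) V :=
  @Functor (QK K) V (under_fun V) factor_hom factor_hom1 factor_homM.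

Lemma factor_compatible : under_compatible factor_functor.
Proof.
refine (@functor_ext _ _ (functor_comp factor_functor (under_fun (QK K)))
  (under_fun V) (fun=> erefl) _) => m n [f x].
exact: factor_homE.
Qed.

End QuotientKernel.

(** * The correspondence between congruence families and quotal categories *)

Lemma congruence_ext (G : crossed_interval_group) (K K' : congruence_family G) :
  (forall m n (f : nabla m n), cong_set K f = cong_set K' f) -> K = K'.
Proof.
case: K K' => s h1 h2 h3 h4 h5 [s' h1' h2' h3' h4' h5'] /= ss'.
have ess : s = s'.
  do 3 apply: functional_extensionality_dep => ?.
  exact: ss'.
case: _ / ess h1' h2' h3' h4' h5' {ss'} => *.
by congr CongruenceFamily; apply: Prop_irrelevance.
Qed.

(** A compatible functor preserves every identification made by the first structure functor, so
    kernels can only grow along it; its inverse gives the other inclusion. *)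
Lemma under_iso_kernel (G : crossed_interval_group)
    (U V : under (total_category G)) m n (f : nabla m n) :
  under_iso U V -> kernel U f = kernel V f.
Proof.
suff sub (U' V' : under (total_category G)) :
    under_iso U' V' -> kernel U' f `<=` kernel V' f.
  by move=> UV; apply/seteqP; split; apply: sub => //; apply: under_iso_sym.
by move=> [F [_ UV]] x; apply: (under_compatible_eq UV).
Qed.

Lemma quotal_iso_QK (G : crossed_interval_group)
    (Q : under (total_category G)) (Q_quotal : quotal Q) :
  under_iso (QK (kernel_congruence Q_quotal)) Q.
Proof.
set K := kernel_congruence Q_quotal.
have sKQ m n (f : nabla m n) : cong_set K f `<=` kernel Q f by [].
have [q_full q_bij _] := Q_quotal.
exists (factor_functor sKQ); split; last exact: factor_compatible.
apply: fully_faithful_bijective_iso => // [m n g|m n p p'].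
  have [[f x] <-] := q_full m n g.
  by exists (quot_class K f x); apply: factor_homE.
have [f [x ->]] := quot_homP p; have [f' [x' ->]] := quot_homP p'.
rewrite /= !factor_homE // => e.
(* Faithfulness: the quotal condition makes the first components agree, and then the second ones
   differ by a kernel element. *)
have ff' := under_hom_fst Q_quotal e; rewrite -ff' in e *.
exact/quot_classP/mem_set/kernelP.
Qed.

Theorem proposition2p8 (G : crossed_interval_group) :
  [/\ forall K : congruence_family G, quotal (QK K),
      forall c : under (total_category G) -> Prop, quotal_class c ->
        exists! K : congruence_family G, iso_class (QK K) = c &
      forall K K' : congruence_family G,
        (forall m n (f : nabla m n), cong_set K f `<=` cong_set K' f) ->
        exists F : functor (QK K) (QK K'), under_compatible F].
Proof.
split=> [K|_ [Q Q_quotal ->]|K K' sKK']; first exact: quotal_QK.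
  exists (kernel_congruence Q_quotal); split=> [|K /iso_classP KQ].
    exact/iso_classP/quotal_iso_QK.
  (* Uniqueness: [K] is the kernel of [QK K], hence that of the isomorphic [Q]. *)
  apply: congruence_ext => m n f.
  by rewrite -(kernel_QK K) (under_iso_kernel f KQ).
have sKV m n (f : nabla m n) : cong_set K f `<=` kernel (QK K') f.
  by rewrite kernel_QK; apply: sKK'.
by exists (factor_functor sKV); apply: factor_compatible.
Qed.
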